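(* For every $n\in\mathbb{N}$, the pair $(\ell_\infty^n,\ell_1^n)$, considered over the complex field $\mathbb{C}$, satisfies the rank invariant Krein-Milman Property of order $1$.
   Context: Here $\ell_\infty^n$ and $\ell_1^n$ denote $\mathbb{C}^n$ with the supremum norm and the $1$-norm, respectively. $\mathbb{L}(\mathbb{X},\mathbb{Y})$ is the space of bounded ($\mathbb{C}$-)linear operators from $\mathbb{X}$ to $\mathbb{Y}$ with the operator norm. An extreme contraction is an extreme point of the unit ball of $\mathbb{L}(\mathbb{X},\mathbb{Y})$. For $r\in\mathbb{N}$, the pair $(\mathbb{X},\mathbb{Y})$ satisfies the rank invariant Krein-Milman Property of order $r$ if every norm one linear operator in $\mathbb{L}(\mathbb{X},\mathbb{Y})$ having rank $r$ can be expressed as a convex combination of extreme contractions in $\mathbb{L}(\mathbb{X},\mathbb{Y})$ having rank $r$. *)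

(* Defs.v *)
(* The real field is a realType R and the complex field is R[i]. *)
From HB Require Import structures.
From mathcomp Require Import all_boot all_order all_algebra.
From mathcomp Require Import complex.
From mathcomp Require Import all_classical all_reals all_analysis.

Set Implicit Arguments.
Unset Strict Implicit.
Unset Printing Implicit Defensive.

Import Order.TTheory GRing.Theory Num.Theory.
Import numFieldNormedType.Exports.

Local Open Scope classical_set_scope.
Local Open Scope ring_scope.
Local Open Scope complex_scope.

(* The library norm on row vectors is already the supremum norm (mx_norm). *)
Definition ell_infty (R : realType) (n : nat) : normedModType R[i] :=
  'rV[R[i]]_n.

(* An alias of the row vectors, so that it can carry another norm. *)
Definition l1_vec (R : realType) (n : nat) : Type := 'rV[R[i]]_n.

Section l1_vec.
Context (R : realType) (n : nat).

HB.instance Definition _ := GRing.Lmodule.copy (l1_vec R n) 'rV[R[i]]_n.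

Definition l1_norm (x : l1_vec R n) : R[i] :=
  \sum_(i < n) `|(x : 'rV[R[i]]_n) ord0 i|.

Lemma l1_normD (x y : l1_vec R n) : l1_norm (x + y) <= l1_norm x + l1_norm y.
Proof.
rewrite /l1_norm -big_split /=; apply: ler_sum => i _.
by rewrite mxE; exact: ler_normD.
Qed.

Lemma l1_normZ (a : R[i]) (x : l1_vec R n) :
  l1_norm (a *: x) = `|a| * l1_norm x.
Proof.
rewrite /l1_norm mulr_sumr; apply: eq_bigr => i _.
by rewrite mxE normrM.
Qed.

Lemma l1_norm_eq0 (x : l1_vec R n) : l1_norm x = 0 -> x = 0.
Proof.
move=> /eqP; rewrite psumr_eq0 // => /allP x0.
apply/rowP => i; rewrite mxE; apply/eqP.
by rewrite -normr_eq0; apply: x0; rewrite mem_index_enum.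
Qed.

HB.instance Definition _ :=
  Lmodule_isNormed.Build R[i] (l1_vec R n) l1_normD l1_normZ l1_norm_eq0.

End l1_vec.

Definition ell_1 (R : realType) (n : nat) : normedModType R[i] := l1_vec R n.

Section operators.
Context (R : realType) (X Y : normedModType R[i]).

(* Operators are handled as elements of the C-module X -> Y of all functions. *)
Definition bounded_operators : set (X -> Y) :=
  [set T | linear T /\ exists M : R, forall x, `|T x| <= M%:C * `|x|].

(* Norms take values in R[i], hence the real part. *)
Definition op_norm (T : X -> Y) : R :=
  sup [set complex.Re `|T x| | x in [set x : X | `|x| <= 1]].

Definition op_unit_ball : set (X -> Y) :=
  [set T | bounded_operators T /\ op_norm T <= 1].

(* The range is spanned by r linearly independent vectors. *)
Definition has_rank (T : X -> Y) (r : nat) : Prop :=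
  exists e : 'I_r -> Y,
    (forall c : 'I_r -> R[i], \sum_(i < r) c i *: e i = 0 ->
       forall i, c i = 0) /\
    range T = [set \sum_(i < r) c i *: e i | c in [set: 'I_r -> R[i]]].

End operators.

Definition extreme_points (R : realType) (E : lmodType R[i]) (A : set E) :
    set E :=
  [set x | A x /\ forall (y z : E) (t : R), A y -> A z -> 0 < t < 1 ->
     x = t%:C *: y + (1 - t)%:C *: z -> y = x /\ z = x].

Definition extreme_contractions (R : realType) (X Y : normedModType R[i]) :
    set (X -> Y) :=
  extreme_points (@op_unit_ball R X Y).

Definition rank_invariant_KMP (R : realType) (X Y : normedModType R[i])
    (r : nat) : Prop :=
  forall T : X -> Y, bounded_operators T -> op_norm T = 1 -> has_rank T r ->
    exists (m : nat) (t : 'I_m -> R) (S : 'I_m -> X -> Y),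
      [/\ forall i, 0 <= t i,
          \sum_(i < m) t i = 1,
          forall i, extreme_contractions (S i) /\ has_rank (S i) r
        & T = \sum_(i < m) (t i)%:C *: S i].

(* Main.v *)
From HB Require Import structures.
Require Import Defs.
From mathcomp Require Import all_boot all_order all_algebra.
From mathcomp Require Import complex.
From mathcomp Require Import all_classical all_reals all_analysis.

(** A rank one operator has the form T x = f(x) b, so its matrix entries are the
products a_j b_i with a_j = f(e_j), and choosing an x of sup norm 1 that
cancels the phases of the a_j shows that its norm is
(sum_j |a_j|)(sum_i |b_i|) = sum_(j,i) |a_j b_i| ([op_norm_rank1]).  When this
norm is 1, writing each entry as its modulus times its phase already exhibits T
as a convex combination of the operators u E_(j,i) : x |-> u x_j e_i with
|u| = 1, the weights being the moduli of the entries.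

Each u E_(j,i) has rank one, so everything rests on its being an extreme
contraction ([basis_op_extreme]).  Suppose it is a proper convex combination of
contractions S and S', and let x be in the face of the unit ball of l_infty^n
where |x_j| = 1.  The i-th coordinate of u E_(j,i) x is unimodular, hence an
extreme point of the disc, so it is also the i-th coordinate of S x and of
S' x.  These vectors have l_1 norm at most 1, so no mass is left for their other
coordinates and S x = S' x = u E_(j,i) x.  As the face spans the whole space,
the three operators coincide. *)

Import Order.TTheory GRing.Theory Num.Theory.
Import numFieldNormedType.Exports.

Local Open Scope classical_set_scope.
Local Open Scope ring_scope.
Local Open Scope complex_scope.

(** * Unimodular complex numbers *)

(** The value 1 at 0 makes every phase unimodular, so that zero matrix entries
need no separate treatment: they get weight 0 on a genuine extreme
contraction. *)
Definition phase {C : numClosedFieldType} (z : C) : C :=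
  if z == 0 then 1 else z / `|z|.

Lemma norm_phase {C : numClosedFieldType} (z : C) : `|phase z| = 1.
Proof.
rewrite /phase; case: eqP => [_|/eqP z0]; first by rewrite normr1.
by rewrite normf_div normr_id divff // normr_eq0.
Qed.

Lemma phaseE {C : numClosedFieldType} (z : C) : `|z| * phase z = z.
Proof.
rewrite /phase; case: eqP => [->|/eqP z0]; first by rewrite normr0 mul0r.
by rewrite mulrC divfK // normr_eq0.
Qed.

Lemma phaseK {C : numClosedFieldType} (z : C) : (phase z)^-1 * z = `|z|.
Proof.
rewrite -[X in _ * X = _]phaseE mulrCA mulVf ?mulr1 //.
by rewrite -normr_eq0 norm_phase oner_eq0.
Qed.

(** Points of the unit circle are extreme in the closed disc: after division
by p, the equality case of the triangle inequality applies to the two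
summands. *)
Lemma extreme_unimodular {C : numClosedFieldType} (t y z p : C) :
  0 < t < 1 -> `|p| = 1 -> `|y| <= 1 -> `|z| <= 1 ->
  p = t * y + (1 - t) * z -> y = p /\ z = p.
Proof.
move=> /andP[t0 t1] p1 y1 z1 pE.
have p0 : p != 0 by rewrite -normr_eq0 p1 oner_eq0.
have s0 : 0 < 1 - t by rewrite subr_gt0.
pose F (b : bool) := (if b then t * y else (1 - t) * z) / p.
pose G (b : bool) := if b then t else 1 - t.
have FG b : true -> `|F b| <= G b.
  move=> _; rewrite /F /G normf_div p1 divr1.
  by case: b; rewrite normrM gtr0_norm // ler_piMr // ltW.
have sumFG : \sum_(b | true) F b = \sum_(b | true) G b.
  by rewrite !big_bool /= -mulrDl -pE divff // subrKC.
have /= FE := normC_sum_upper FG sumFG.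
split.
- have /(canRL (divfK p0)) := FE true isT.
  by rewrite /F /G => /mulfI; apply; rewrite gt_eqF.
- have /(canRL (divfK p0)) := FE false isT.
  by rewrite /F /G => /mulfI; apply; rewrite gt_eqF.
Qed.

(** * Operator norm and rank one operators *)

Section operator_norm.
Context {R : realType} {X Y : normedModType R[i]}.
Implicit Types T : X -> Y.

(** Boundedness is essential here: on a set that is not bounded above the
supremum is a junk value. *)
Lemma op_norm_ge T x : bounded_operators T -> `|x| <= 1 ->
  `|T x| <= (op_norm T)%:C.
Proof.
move=> [_ [M TM]] x1.
rewrite -[leLHS]RRe_real ?normr_real // lecR.
apply: ub_le_sup; last by exists x.
exists `|M| => _ [u u1 <-].
rewrite -lecR RRe_real ?normr_real //.
apply: (le_trans (TM u)).
apply: (le_trans (y := `|M|%:C * `|u|)).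
  by apply: ler_wpM2r => //; rewrite lecR ler_norm.
by apply: ler_piMr => //; rewrite lecR.
Qed.

Lemma op_norm_le T (M : R) : (forall x, `|x| <= 1 -> `|T x| <= M%:C) ->
  op_norm T <= M.
Proof.
move=> TM; apply: ge_sup.
  by exists (complex.Re `|T 0|), 0 => //=; rewrite normr0.
move=> _ [u u1 <-]; rewrite -lecR RRe_real ?normr_real //; exact: TM.
Qed.

(** The coefficient of T x on the spanning vector of the range is unique,
because that vector is independent; uniqueness makes it linear in x. *)
Lemma has_rank1P T : linear T -> has_rank T 1 ->
  exists (f : X -> R[i]) (b : Y), scalar f /\ forall x, T x = f x *: b.
Proof.
move=> Tlin [e [e_free rangeT]].
have e0 c : c *: e ord0 = 0 -> c = 0.
  move=> ce; apply: (e_free (fun=> c) _ ord0).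
  by rewrite big_ord1.
have /choice[f Tf] x : exists c, T x = c *: e ord0.
  have : range T (T x) by exists x.
  by rewrite rangeT => -[c _ <-]; exists (c ord0); rewrite big_ord1.
exists f, (e ord0); split => // a u v.
apply/eqP; rewrite -subr_eq0; apply/eqP/e0.
by rewrite scalerBl scalerDl -Tf Tlin !Tf scalerA subrr.
Qed.

Lemma rank1_has_rank (f : X -> R[i]) (b : Y) (x0 : X) : b != 0 -> f x0 != 0 ->
  (forall (a : R[i]) x, f (a *: x) = a * f x) ->
  has_rank (fun x => f x *: b) 1.
Proof.
move=> b0 fx0 fZ; exists (fun=> b); split.
  move=> c; rewrite big_ord1 => /eqP; rewrite scaler_eq0 (negbTE b0) orbF.
  by move=> /eqP c0 i; rewrite ord1.
apply/seteqP; split => [_ [x _ <-]|_ [c _ <-]].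
  by exists (fun=> f x) => //; rewrite big_ord1.
exists ((c ord0 / f x0) *: x0) => //.
by rewrite big_ord1 fZ divfK.
Qed.

End operator_norm.

(** * The spaces of finite sequences *)

Section ell.
Context {R : realType} {n : nat}.
Local Notation X := (ell_infty R n).
Local Notation Y := (ell_1 R n).

Lemma ell_infty_norm_le (x : X) (M : R[i]) : 0 <= M ->
  (`|x| <= M) <-> (forall j, `|(x : 'rV_n) ord0 j| <= M).
Proof.
move=> /nonnegP[{}M]; have -> : `|x| = mx_norm (x : 'rV[R[i]]_n) by [].
rewrite mx_normE num_le; split=> [/bigmax_leP[_ xM] j|xM].
  by have := xM (ord0, j) isT; rewrite -num_le.
apply/bigmax_leP; split; first by rewrite -num_le /=.
by move=> [i j] _; rewrite -num_le /= ord1; exact: xM.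
Qed.

Lemma ell_infty_coord_le (x : X) j : `|(x : 'rV_n) ord0 j| <= `|x|.
Proof. by move: j; apply/(@ell_infty_norm_le x `|x|). Qed.

Lemma ell_1_coord_le (y : Y) i : `|(y : 'rV_n) ord0 i| <= `|y|.
Proof.
rewrite /Num.norm /= /l1_norm (bigD1 i) //= lerDl.
by apply: sumr_ge0.
Qed.

Lemma ell_1_norm_delta (c : R[i]) (i : 'I_n) :
  `|(c *: (delta_mx ord0 i : 'rV_n) : Y)| = `|c|.
Proof.
rewrite /Num.norm /= /l1_norm (bigD1 i) //= big1 => [|k ki].
  by rewrite !mxE !eqxx mulr1 addr0.
by rewrite !mxE eqxx (negbTE ki) mulr0 normr0.
Qed.

(** A coordinate of modulus 1 exhausts the l_1 norm of a vector of the unit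
ball. *)
Lemma ell_1_norm1_delta (y : Y) i : `|y| <= 1 -> `|(y : 'rV_n) ord0 i| = 1 ->
  y = (y : 'rV_n) ord0 i *: (delta_mx ord0 i : 'rV_n).
Proof.
rewrite {1}/Num.norm /= /l1_norm (bigD1 i) //= => y1 yi.
move: y1; rewrite yi gerDl => y0.
have /eqP : \sum_(k < n | k != i) `|(y : 'rV_n) ord0 k| = 0.
  by apply/eqP; rewrite eq_le y0 sumr_ge0.
rewrite psumr_eq0 // => /allP yk.
apply/rowP => k; rewrite !mxE eqxx /=; have [->|ki] := eqVneq k i.
  by rewrite mulr1.
have := yk k (mem_index_enum _); rewrite ki normr_eq0 => /eqP ->.
by rewrite mulr0.
Qed.

(** * The extreme contractions u E_(j,i) *)

Definition basis_op (j i : 'I_n) (u : R[i]) (x : X) : Y :=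
  (u * (x : 'rV_n) ord0 j) *: (delta_mx ord0 i : 'rV_n).

Lemma basis_op_linear j i u : linear (basis_op j i u).
Proof.
move=> a x y; rewrite /basis_op !mxE mulrDr scalerDl scalerA.
by congr (_ *: _ + _); rewrite mulrCA.
Qed.

(** The face |x_j| = 1 of the unit ball spans the space: it contains e_j, and
also e_j + s (x - x_j e_j) for every x once s > 0 is small enough. *)
Lemma linear_eq_on_face (S T : X -> Y) (j : 'I_n) : linear S -> linear T ->
  (forall x : X, `|x| <= 1 -> `|(x : 'rV_n) ord0 j| = 1 -> S x = T x) ->
  S = T.
Proof.
move=> Slin Tlin ST; apply/funext => x.
pose d : X := (delta_mx ord0 j : 'rV_n).
(* The 1 keeps M positive when x = 0; s = 1 / M is then small enough. *)
pose M : R[i] := 1 + `|x|.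
have M0 : 0 < M by rewrite ltr_pwDl.
pose p : X := d + M^-1 *: (x - (x : 'rV_n) ord0 j *: d).
(* The final 0 puts the sum in the shape a *: u + v of the linearity law. *)
have xE : x = M *: p + (((x : 'rV_n) ord0 j - M) *: d + 0).
  rewrite addr0 /p scalerDr scalerA divff ?gt_eqF // scale1r scalerBl.
  by rewrite addrC addrA subrK addrC subrK.
have dj : (d : 'rV_n) ord0 j = 1 by rewrite mxE !eqxx.
have pj : (p : 'rV_n) ord0 j = 1.
  by rewrite !mxE !eqxx mulr1 subrr mulr0 addr0.
have d1 : `|d| <= 1.
  apply/ell_infty_norm_le => // k; rewrite mxE eqxx /=.
  by case: eqP => _; rewrite ?normr1 ?normr0.
have p1 : `|p| <= 1.
  apply/ell_infty_norm_le => // k.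
  have [->|kj] := eqVneq k j; first by rewrite pj normr1.
  rewrite !mxE eqxx (negbTE kj) mulr0 subr0 add0r normrM normfV.
  rewrite (gtr0_norm M0) mulrC ler_pdivrMr // mul1r.
  apply: (le_trans (y := `|x|)); last by rewrite lerDr.
  exact: ell_infty_coord_le.
have [S0 T0] : S 0 = 0 /\ T 0 = 0.
  by split; [have := Slin (-1) 0 0|have := Tlin (-1) 0 0];
    rewrite scaleN1r addNr => ->; rewrite scaleN1r addNr.
rewrite xE !Slin !Tlin S0 T0 (ST p) ?pj ?normr1 // (ST d) //.
by rewrite dj normr1.
Qed.

Lemma basis_op_unit_ball j i u : `|u| = 1 -> op_unit_ball (basis_op j i u).
Proof.
move=> u1.
have basis_op_le x : `|basis_op j i u x| <= `|x|.
  rewrite /basis_op ell_1_norm_delta normrM u1 mul1r.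
  exact: ell_infty_coord_le.
split; first split.
- exact: basis_op_linear.
- by exists 1 => x; rewrite mul1r.
- by apply: op_norm_le => x; exact: le_trans (basis_op_le x).
Qed.

(** On the face |x_j| = 1 the i-th coordinate of the image is unimodular; this
pins down that coordinate, then the whole image, then the operator. *)
Lemma basis_op_extreme j i u : `|u| = 1 ->
  extreme_contractions (basis_op j i u).
Proof.
move=> u1; split; first exact: basis_op_unit_ball.
move=> S T t [Sbd S1] [Tbd T1] /andP[t0 t1] BE.
have ballP (V : X -> Y) : bounded_operators V -> op_norm V <= 1 ->
    forall x : X, `|x| <= 1 -> `|V x| <= 1.
  move=> Vbd V1 x x1; apply: le_trans (op_norm_ge V x Vbd x1) _.
  by rewrite lecR.
have {}S1 := ballP _ Sbd S1; have {}T1 := ballP _ Tbd T1.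
have onface x : `|x| <= 1 -> `|(x : 'rV_n) ord0 j| = 1 ->
    S x = basis_op j i u x /\ T x = basis_op j i u x.
  move=> x1 xj.
  have p1 : `|u * (x : 'rV_n) ord0 j| = 1 by rewrite normrM u1 xj mulr1.
  have [|||||Si Ti] := @extreme_unimodular _ t%:C ((S x : 'rV_n) ord0 i)
      ((T x : 'rV_n) ord0 i) (u * (x : 'rV_n) ord0 j).
  - by rewrite ltcR t0 ltcR.
  - exact: p1.
  - exact: le_trans (ell_1_coord_le _ _) (S1 _ x1).
  - exact: le_trans (ell_1_coord_le _ _) (T1 _ x1).
  - have := congr1 (fun V : X -> Y => (V x : 'rV_n) ord0 i) BE.
    rewrite /basis_op !mxE !eqxx mulr1 => ->.
    by rewrite rmorphB.
  split.
  - by rewrite (ell_1_norm1_delta _ i (S1 _ x1)) Si.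
  - by rewrite (ell_1_norm1_delta _ i (T1 _ x1)) Ti.
split; apply: (linear_eq_on_face _ _ j).
- by case: Sbd.
- exact: basis_op_linear.
- by move=> x x1 xj; case: (onface x).
- by case: Tbd.
- exact: basis_op_linear.
- by move=> x x1 xj; case: (onface x).
Qed.

Lemma basis_op_rank1 j i u : `|u| = 1 -> has_rank (basis_op j i u) 1.
Proof.
move=> u1.
apply: (rank1_has_rank (fun x : X => u * (x : 'rV_n) ord0 j)
  (delta_mx ord0 i : 'rV_n) (delta_mx ord0 j : 'rV_n)).
- apply/eqP => /(congr1 (fun y : 'rV[R[i]]_n => y ord0 i)) /eqP.
  by rewrite !mxE !eqxx oner_eq0.
- by rewrite mxE !eqxx mulr1 -normr_eq0 u1 oner_eq0.
- by move=> a x; rewrite mxE mulrCA.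
Qed.

(** * Rank one operators from l_infty to l_1 *)

(** The supremum is reached at the vector whose coordinates undo the phases of
the a_j. *)
Lemma op_norm_rank1 (a : 'I_n -> R[i]) (b : Y) (T : X -> Y) :
  bounded_operators T ->
  (forall x, T x = (\sum_j (x : 'rV_n) ord0 j * a j) *: b) ->
  (op_norm T)%:C = (\sum_j `|a j|) * `|b|.
Proof.
move=> Tbd TE; apply/le_anti/andP; split.
  have L0 : 0 <= (\sum_j `|a j|) * `|b| by rewrite mulr_ge0 // sumr_ge0.
  rewrite -[leRHS]RRe_real ?ger0_real // lecR; apply: op_norm_le => x x1.
  rewrite RRe_real ?ger0_real // TE normrZ ler_wpM2r //.
  apply: le_trans (ler_norm_sum _ _ _) _; apply: ler_sum => j _.
  by rewrite normrM ler_piMl //; exact: le_trans (ell_infty_coord_le _ _) x1.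
pose x : X := (\row_j (phase (a j))^-1 : 'rV_n).
have x1 : `|x| <= 1.
  by apply/ell_infty_norm_le => // j; rewrite mxE normfV norm_phase invr1.
have := op_norm_ge T x Tbd x1; rewrite TE normrZ.
under eq_bigr do rewrite mxE phaseK.
by rewrite ger0_norm // sumr_ge0.
Qed.

(** Each matrix entry a_j b_i splits into its modulus, which becomes the weight,
and its phase, which goes into the matrix unit. *)
Lemma rank1_basis_op_sum (a : 'I_n -> R[i]) (b : Y) (x : X) :
  (\sum_j (x : 'rV_n) ord0 j * a j) *: b =
  \sum_(p : 'I_n * 'I_n) `|a p.1 * (b : 'rV_n) ord0 p.2| *:
     basis_op p.1 p.2 (phase (a p.1 * (b : 'rV_n) ord0 p.2)) x.
Proof.
rewrite -(pair_bigA _ (fun j i => `|a j * (b : 'rV_n) ord0 i| *: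
  basis_op j i (phase (a j * (b : 'rV_n) ord0 i)) x)) /= scaler_suml.
apply: eq_bigr => j _.
rewrite [in LHS](row_sum_delta (b : 'rV_n)) scaler_sumr; apply: eq_bigr => i _.
rewrite /basis_op !scalerA; congr (_ *: _).
by rewrite mulrA phaseE -mulrA mulrC.
Qed.

End ell.

Theorem theorem2p12 (R : realType) (n : nat) (hn : (0 < n)%N) :
  rank_invariant_KMP (ell_infty R n) (ell_1 R n) 1.
Proof.
move=> T Tbd T1 Trank.
have [f [b [flin TE]]] := has_rank1P T Tbd.1 Trank.
pose a j := f (delta_mx ord0 j : 'rV_n).
have {}TE x : T x = (\sum_j (x : 'rV_n) ord0 j * a j) *: b.
  rewrite TE; congr (_ *: _).
  pose F : {scalar 'rV[R[i]]_n} :=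
    HB.pack f (GRing.isLinear.Build R[i] 'rV[R[i]]_n R[i] _ f flin).
  rewrite -[f]/(F : _ -> _) {1}(row_sum_delta (x : 'rV_n)) linear_sum.
  by apply: eq_bigr => j _; rewrite linearZ.
pose c (p : 'I_n * 'I_n) := a p.1 * (b : 'rV_n) ord0 p.2.
exists #|{: 'I_n * 'I_n}|, (fun k => complex.Re `|c (enum_val k)|),
  (fun k => basis_op (enum_val k).1 (enum_val k).2 (phase (c (enum_val k)))).
split.
- by move=> k; rewrite -ler0c RRe_real ?normr_real.
- apply: (@complexI R); rewrite rmorph_sum.
  rewrite (eq_bigr (fun k => `|c (enum_val k)|)) => [|k _]; last first.
    exact: RRe_real (normr_real _).
  rewrite -(big_enum_val (A := predT) (fun p => `|c p|)) /=.
  have := op_norm_rank1 _ _ _ Tbd TE; rewrite T1 => ->.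
  rewrite -(pair_bigA _ (fun j i => `|c (j, i)|)) /= mulr_suml.
  apply: eq_bigr => j _; rewrite [`|b|]/Num.norm /= /l1_norm mulr_sumr.
  by apply: eq_bigr => i _; rewrite normrM.
- by move=> k; split;
    [apply: basis_op_extreme|apply: basis_op_rank1]; exact: norm_phase.
- apply/funext => x; rewrite fct_sumE TE rank1_basis_op_sum.
  rewrite (big_enum_val (A := predT) (fun p => `|c p| *:
    basis_op p.1 p.2 (phase (c p)) x)).
  by apply: eq_bigr => k _; rewrite RRe_real ?normr_real.
Qed.
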